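(* Let $\alpha\in(0,1)$ and let $u_\alpha(k)$, $k\ge1$, be either the linear boundary $u_\alpha(k)=\sqrt{\frac{-\log\alpha}{2m}}\,k+\sqrt{\frac{-m\log\alpha}{2}}$ (for a fixed $m>0$) or the curved boundary $u_\alpha(k)=1.7\sqrt{k(\log\log(2k)+0.72\log\frac{5.2}{\alpha})}$. Suppose the $p$-values $(p_i)_{i\in\mathcal I}$ are independent and mirror-conservative. Then both versions of the adaptively ordered martingale test described below reject with probability at most $\alpha$: (Batch version, $\mathcal I=\{1,\dots,n\}$.) Set $M_0=\emptyset$ and for $k=1,\dots,n$ let $M_k=M_{k-1}\cup\{i_k\}$, where $i_k\in\arg\min_{i\notin M_{k-1}} g(p_i)$; reject if there exists $k\in\{1,\dots,n\}$ with $\sum_{i\in M_k}h(p_i)>u_\alpha(k)$. (Online version, $\mathcal I=\mathbb N$, with a fixed threshold parameter $c$.) Process $t=1,2,\dots$ in order; hypothesis $t$ is included into the current set $M$ (and the counter $k=|M|$ increases by one) if and only if $g(p_t)<c$; reject if at some time the current set $M$ with $k=|M|\ge1$ satisfies $\sum_{i\in M}h(p_i)>u_\alpha(k)$.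
   Context: For a $p$-value $p$ define the missing bit $h(p)=2\cdot\mathbf 1\{p<0.5\}-1\in\{-1,1\}$ and the masked $p$-value $g(p)=\min\{p,1-p\}$. A $p$-value $p_i$ with probability mass function (if discrete) or density (otherwise) $f_i$ is called mirror-conservative if $f_i(a)\le f_i(1-a)$ for all $0\le a\le 0.5$. These assumptions describe the global null hypothesis; the probability of rejection under them is the type-I error.
   Formalization: In the batch version, ties in the argmin of g(p_i) are broken by smallest index; with an arbitrary choice among minimizers, possibly depending on the missing bits h, the claim fails for discrete p-values. *)

(* Defs.v *)
From HB Require Import structures.
From mathcomp Require Import all_boot all_order all_algebra.
From mathcomp Require Import all_classical all_reals all_analysis.
Set Implicit Arguments. Unset Strict Implicit. Unset Printing Implicit Defensive.
Import Order.TTheory GRing.Theory Num.Theory.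
Local Open Scope classical_set_scope.
Local Open Scope ring_scope.

Section Defs.
Variable R : realType.

Definition hbit (p : R) : R := if p < 2^-1 then 1 else -1.
Definition gmask (p : R) : R := Num.min p (1 - p).

Definition lin_boundary (m alpha : R) (k : nat) : R :=
  Num.sqrt (- ln alpha / (2 * m)) * k%:R + Num.sqrt (- (m * ln alpha) / 2).

Definition curved_boundary (alpha : R) (k : nat) : R :=
  (17 / 10) * Num.sqrt (k%:R * (ln (ln (2 * k%:R)) + (72 / 100) * ln ((52 / 10) / alpha))).

Variables (d : measure_display) (T : measurableType d) (P : probability T R).

Definition mutually_independent (I : eqType) (X : I -> T -> R) : Prop :=
  forall (J : seq I) (B : I -> set R),
    uniq J -> (forall j, j \in J -> measurable (B j)) ->
    P (\bigcap_(j in [set` J]) (X j @^-1` B j)) =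
    (\prod_(j <- J) P (X j @^-1` B j))%E.

Definition mirror_conservative (X : T -> R) : Prop :=
  (exists S : set R, countable S /\ P (X @^-1` S) = 1%E /\
     forall a, 0 <= a <= 2^-1 ->
       (P (X @^-1` [set a%R]) <= P (X @^-1` [set (1 - a)%R]))%E)
  \/
  (exists f : R -> R, measurable_fun setT f /\ (forall x, 0 <= f x) /\
     (forall A, measurable A ->
        (P (X @^-1` A) = \int[@lebesgue_measure R]_(x in A) (f x)%:E)%E) /\
     forall a, 0 <= a <= 2^-1 -> f a <= f (1 - a)).

(* Batch version.  Position of hypothesis i in the ordering by increasing
   masked p-value, ties broken by smallest index:
   M_k = { i | brank q i < k }. *)
Definition brank (n : nat) (q : 'I_n -> R) (i : 'I_n) : nat :=
  #|[set j : 'I_n | (q j < q i) || ((q j == q i) && (j < i)%N)]|.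

Definition batch_sum (n : nat) (p : 'I_n -> T -> R) (k : nat) (w : T) : R :=
  \sum_(i : 'I_n | (brank (fun j => gmask (p j w)) i < k)%N) hbit (p i w).

Definition batch_reject (u : nat -> R) (n : nat) (p : 'I_n -> T -> R) : set T :=
  [set w | exists k : nat, (1 <= k <= n)%N /\ u k < batch_sum p k w].

(* Online version: after processing hypotheses 0, ..., t-1, the current set
   is M = { i < t | g(p_i) < c }. *)
Definition online_count (c : R) (p : nat -> T -> R) (t : nat) (w : T) : nat :=
  \sum_(i < t | gmask (p i w) < c) 1%N.

Definition online_sum (c : R) (p : nat -> T -> R) (t : nat) (w : T) : R :=
  \sum_(i < t | gmask (p i w) < c) hbit (p i w).

Definition online_reject (u : nat -> R) (c : R) (p : nat -> T -> R) : set T :=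
  [set w | exists t : nat, (1 <= online_count c p t w)%N /\
                           u (online_count c p t w) < online_sum c p t w].
End Defs.

(* Main.v *)
Require Import Defs.
From HB Require Import structures.
From mathcomp Require Import all_boot all_order all_algebra.
From mathcomp Require Import all_classical all_reals all_analysis.
From mathcomp Require Import measurable_realfun.
From mathcomp Require Import ring lra zify.
Set Implicit Arguments. Unset Strict Implicit. Unset Printing Implicit Defensive.
Import Order.TTheory GRing.Theory Num.Theory.
Local Open Scope classical_set_scope.
Local Open Scope ring_scope.

(* Cut the range of the masked p-values into finitely many cells that are
   symmetric under [x |-> 1 - x].  Given the cells, the order of inclusion is
   fixed, and mirror-conservativeness says that each missing bit is [1] with
   probability at most [1/2]; hence [exp (l S_k - l^2 k / 2)] is a
   supermartingale and Ville's inequality bounds the crossing of any line.  The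
   linear boundary is such a line.  The curved one lies above one line on each
   epoch [2^j <= k < 2^(j+1)] with [j >= 1], at levels whose error probabilities
   sum to at most [alpha], while for [k = 1] it exceeds [1].  The online test
   only uses the two cells [g < c] and [g >= c]; the batch test is the limit of
   the tests that order by [g] at resolution [1/N], because for each outcome the
   resolved order agrees with the true one for all large [N]. *)

(** * Elementary estimates for exponentials, logarithms and a zeta-type sum *)

Lemma fact_double_ge (n : nat) : (2 ^ n * n`! <= (n.*2)`!)%N.
Proof.
elim: n => [//|n IH]; rewrite doubleS !factS expnS.
by have := leq_mul (leqnn (n.+1 * 2)) IH; rewrite -muln2; nia.
Qed.

(** Compare the exponential series term by term: the odd terms cancel, and the even ones satisfy
    [x^(2n) / (2n)! <= (x^2 / 2)^n / n!] because [2^n n! <= (2n)!]. *)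
Lemma expR_cosh_le (R : realType) (x : R) :
  expR x + expR (- x) <= 2 * expR (x ^+ 2 / 2).
Proof.
pose b k : R := exp_coeff x k + exp_coeff (- x) k.
have b0 k : 0 <= b k.
  rewrite /b /exp_coeff /= (exprNn x) -mulrDl mulr_ge0 ?invr_ge0//.
  rewrite -signr_odd; case: (boolP (odd k)) => ok.
    by rewrite expr1 mulN1r subrr.
  by rewrite expr0 mul1r addr_ge0 // exprn_even_ge0 // (negbTE ok).
have even N : \sum_(0 <= k < N.*2) b k <= 2 * series (exp_coeff (x ^+ 2 / 2)) N.
  elim: N => [|N IH]; first by rewrite /series /= !big_geq // mulr0.
  rewrite doubleS !big_nat_recr //= /series /= big_nat_recr //= mulrDr.
  rewrite -addrA; apply: lerD IH _; rewrite /b /exp_coeff /= !(exprNn x).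
  rewrite -(signr_odd _ N.*2) -(signr_odd _ N.*2.+1) /= odd_double /=.
  rewrite expr0 expr1 mul1r mulN1r mulNr subrr addr0 -mulr2n -[leLHS]mulr_natl.
  rewrite ler_pM2l // -mul2n exprM expr_div_n -mulrA ler_wpM2l ?(exprn_ge0 _ (sqr_ge0 x)) //.
  rewrite -invfM lef_pV2 ?posrE ?mulr_gt0 ?ltr0n ?fact_gt0 ?exprn_gt0 //.
  by rewrite -natrX -natrM ler_nat mul2n fact_double_ge.
have -> : expR x + expR (- x) =
    limn (series (exp_coeff x) \+ series (exp_coeff (- x))).
  by rewrite limD //; exact: is_cvg_series_exp_coeff.
apply: limr_le.
  by apply: is_cvgD; exact: is_cvg_series_exp_coeff.
apply: nearW => n /=; rewrite /series /= -big_split /=.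
apply: (le_trans (y := \sum_(0 <= k < n.*2) b k)).
  by apply: (nondecreasing_series (u_ := b) (P := predT)) => [*|]; rewrite ?b0 // -addnn leq_addr.
apply: (le_trans (even n)); rewrite ler_pM2l //.
apply: nondecreasing_cvgn_le; last exact: is_cvg_series_exp_coeff.
apply: nondecreasing_series => k _ _; rewrite /exp_coeff /=.
by rewrite mulr_ge0 ?invr_ge0 ?exprn_ge0 ?divr_ge0 ?sqr_ge0.
Qed.

(** The supermartingale step: revealing a fair sign multiplies [exp (l S_k - l^2 k / 2)] by one of
    these two terms, whose mean is at most 1. *)
Lemma expR_sub_half_sqr_le (R : realType) (l : R) :
  expR (l - l ^+ 2 / 2) + expR (- l - l ^+ 2 / 2) <= 2.
Proof.
rewrite !expRD -mulrDl [expR (- (_ / _))]expRN.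
by rewrite ler_pdivrMr ?expR_gt0 // expR_cosh_le.
Qed.

Lemma ln2_ge (R : realType) : 2 / 3 <= ln 2 :> R.
Proof.
have h : 14 / 15 <= expR (- (1 / 15)) :> R.
  by apply: le_trans (expR_ge1Dx _); lra.
have h2 : expR (2 / 3) <= 2 :> R.
  (* The tangent bound at [2 / 3] itself is too weak. Cut into ten steps of [1 / 15] it suffices,
     since [(14 / 15)^10 > 1 / 2]. *)
  have -> : 2 / 3 = - (- (1 / 15) * 10%:R) :> R by lra.
  rewrite expRN expRM_natr -[leRHS]invrK lef_pV2 ?posrE ?invr_gt0 ?exprn_gt0 ?expR_gt0//.
  have : (14 / 15) ^+ 10 <= expR (- (1 / 15)) ^+ 10 :> R.
    by rewrite lerXn2r ?nnegrE ?expR_ge0 //; lra.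
  by apply: le_trans; lra.
by rewrite -ler_expR lnK ?posrE.
Qed.

Lemma expR_ln3half_le (R : realType) : expR (7 / 5 * ln (3 / 2)) <= 2 :> R.
Proof.
have l0 : 0 <= ln (3 / 2) :> R by apply: ln_ge0; lra.
(* Raising the exponent from [7 / 5] to [3 / 2] leaves, after squaring, [(3 / 2)^3 <= 4]. *)
apply: (le_trans (y := expR (3 / 2 * ln (3 / 2)))).
  by rewrite ler_expR; nra.
rewrite -ler_sqr ?nnegrE ?expR_ge0 // -expRM_natr.
have -> : 3 / 2 * ln (3 / 2) * 2%:R = ln (3 / 2) * 3%:R :> R by lra.
by rewrite expRM_natr lnK ?posrE; lra.
Qed.

(* Tangent-line bound at [i.+1] for the convex function [x ^ (-2/5)]. *)
Lemma zeta_term_le (R : realType) (i : nat) : (0 < i)%N ->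
  expR (- (7 / 5) * ln i.+1%:R) <=
  5 / 2 * (expR (- (2 / 5) * ln i%:R) - expR (- (2 / 5) * ln i.+1%:R)) :> R.
Proof.
move=> i0; set a := ln i%:R; set b := ln i.+1%:R.
have iR : 0 < i%:R :> R by rewrite ltr0n.
have jR : 0 < i.+1%:R :> R by rewrite ltr0n.
have eb : expR (- b) = i.+1%:R^-1 by rewrite expRN lnK ?posrE.
have ab : expR (- b) <= b - a.
  have -> : b - a = - ln (i%:R / i.+1%:R) by rewrite ln_div ?posrE // opprB.
  have e1 : i%:R / i.+1%:R = 1 + (- i.+1%:R^-1) :> R.
    apply: (mulIf (lt0r_neq0 jR)).
    by rewrite mulrDl mulNr divfK ?mulVf ?lt0r_neq0 // mul1r -natr1 addrK.
  rewrite eb e1 lerNr; apply: le_ln1Dx.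
  by rewrite ltrN2 invf_lt1 // ltr1n ltnS.
have -> : - (7 / 5) * b = - (2 / 5) * b + (- b) by lra.
have -> : - (2 / 5) * a = - (2 / 5) * b + (2 / 5) * (b - a) by lra.
rewrite !expRD.
have E0 := expR_gt0 (- (2 / 5) * b); set E := expR _ in E0 *.
have := expR_ge1Dx (2 / 5 * (b - a)); set F := expR (_ * (b - a)) => F1.
set G := expR (- b) in ab *.
have : E * (G - 5 / 2 * (F - 1)) <= 0 by rewrite pmulr_rle0 //; lra.
by lra.
Qed.

Lemma sum_zeta_le (R : realType) (J : nat) :
  \sum_(1 <= i < J.+1) expR (- (7 / 5) * ln i.+1%:R) <= 5 / 2 :> R.
Proof.
pose f i : R := expR (- (2 / 5) * ln i%:R).
apply: (le_trans (y := 5 / 2 * \sum_(1 <= i < J.+1) (f i - f i.+1))).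
  rewrite mulr_sumr; apply: ler_sum_nat => i /andP[i0 _]; exact: zeta_term_le.
under eq_bigr do rewrite -opprB.
rewrite sumrN telescope_sumr // opprB /f ln1 mulr0 expR0.
by have := expR_ge0 (- (2 / 5) * ln J.+1%:R : R); lra.
Qed.

(** * Covering the boundaries by lines *)

(* A pair [(l, x)] stands for the line [k |-> x / l + l k / 2], which the signs
   cross with probability at most [expR (- x)]. *)
Definition line_dominated (R : realType) (u : nat -> R) (alpha : R) (n : nat) :=
  exists L : seq (R * R),
    [/\ forall v, v \in L -> 0 <= v.1,
        \sum_(v <- L) expR (- v.2) <= alpha &
        forall (k : nat) (s : R), (0 < k <= n)%N -> s <= k%:R -> u k < s ->
          exists2 v, v \in L & v.2 <= v.1 * s - v.1 ^+ 2 / 2 * k%:R].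

(** One line is enough. Matching slope [a] and intercept [b] with [l / 2] and [x / l] gives
    [l = 2 a] and [x = 2 a b = - ln alpha], so its error is exactly [alpha]. *)
Lemma lin_boundary_dominated (R : realType) (m alpha : R) (n : nat) :
  0 < alpha < 1 -> 0 < m -> line_dominated (lin_boundary m alpha) alpha n.
Proof.
move=> /andP[a0 a1] m0.
have l0 : ln alpha < 0 by apply: ln_lt0; rewrite a0 a1.
have q0 : 0 <= - ln alpha / (2 * m) by rewrite divr_ge0 ?mulr_ge0; lra.
have r0 : 0 <= - (m * ln alpha) / 2.
  by rewrite divr_ge0 // -mulrN mulr_ge0; lra.
set a := Num.sqrt (- ln alpha / (2 * m)).
set b := Num.sqrt (- (m * ln alpha) / 2).
have a00 : 0 <= a by exact: sqrtr_ge0.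
have ab : a * b = - ln alpha / 2.
  rewrite /a /b -sqrtrM // -[RHS]ger0_norm; last by lra.
  rewrite -sqrtr_sqr; congr Num.sqrt; field; lra.
exists [:: (2 * a, - ln alpha)]; split.
- by move=> v; rewrite inE => /eqP -> /=; lra.
- by rewrite big_seq1 /= opprK lnK ?posrE.
- move=> k s _ _; rewrite /lin_boundary -/a -/b => us.
  exists (2 * a, - ln alpha); rewrite ?mem_head //=.
  have : a * (a * k%:R + b) <= a * s by rewrite ler_wpM2l // ltW.
  by lra.
Qed.

Lemma ln_curved_constant_ge (R : realType) (alpha : R) :
  0 < alpha < 1 -> 4 / 3 <= ln (52 / 10 / alpha).
Proof.
move=> /andP[a0 a1].
apply: (le_trans (y := ln (2 ^+ 2))).
  by rewrite lnXn ?posrE // -mulr_natl; have := ln2_ge R; lra.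
rewrite ler_ln ?posrE ?divr_gt0 //.
by rewrite ler_pdivlMr //; lra.
Qed.

(* With [v = 7 / 5 * 2 ^ j] the window contains [2 ^ j <= k <= 2 ^ j.+1]; the
   claim comes down to [(1 + r) ^ 2 <= (17 / 10) ^ 2 / (7 / 5) * 2 r] for
   [5 / 7 <= r <= 10 / 7], which is tight at [r = 10 / 7]. *)
Lemma tangent_line_le (R : realType) (v x q k s : R) :
  0 < v -> 0 <= x -> 7 / 10 * k <= v <= 7 / 5 * k -> 5 / 7 * x <= q ->
  17 / 10 * Num.sqrt (k * q) <= s ->
  x <= Num.sqrt (2 * x / v) * s - Num.sqrt (2 * x / v) ^+ 2 / 2 * k.
Proof.
move=> v0 x0 /andP[kv vk] xq us.
have k0 : 0 < k by lra.
have w0 : 0 <= 2 * x / v by rewrite divr_ge0 ?mulr_ge0 // ltW.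
rewrite sqr_sqrtr // lerBrDr.
have -> : x + 2 * x / v / 2 * k = x * (1 + k / v) by field; lra.
apply: le_trans (ler_wpM2l (sqrtr_ge0 _) us).
have kq : 0 <= k * q by rewrite mulr_ge0; lra.
rewrite mulrCA -sqrtrM // -ler_sqr ?nnegrE; last 2 first.
- by rewrite mulr_ge0 // addr_ge0 // divr_ge0 ?ltW.
- by rewrite mulr_ge0 ?sqrtr_ge0 //; lra.
rewrite [leRHS]exprMn (sqr_sqrtr (mulr_ge0 w0 kq)).
set r := k / v.
have rE : r * v = k by rewrite /r divfK ?gt_eqF.
have r1 : r <= 10 / 7 by rewrite ler_pdivrMr //; lra.
have r2 : 5 / 7 <= r by rewrite ler_pdivlMr //; lra.
have -> : 2 * x / v * (k * q) = 2 * x * q * r by rewrite /r; field; lra.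
have h : (1 + r) ^+ 2 <= 289 / 70 * r by nra.
rewrite exprMn.
apply: (le_trans (y := x ^+ 2 * (289 / 70 * r))).
  by rewrite ler_wpM2l ?sqr_ge0.
have : 0 <= x * r * (q - 5 / 7 * x) by apply: mulr_ge0; [apply: mulr_ge0|]; lra.
by lra.
Qed.

(** As [j.+1%:R * ln 2] is the logarithm of [2 * 2 ^ j], this is about [7 / 5] times the bracket
    under the root of the curved boundary at [k = 2 ^ j]. The coefficient of the last term may be 1
    because [7 / 5 * 72 / 100 >= 1]. *)
Definition epoch_level (R : realType) (alpha : R) (j : nat) : R :=
  7 / 5 * ln (j.+1%:R * ln 2) + ln (52 / 10 / alpha).

(** Each term equals [alpha / 5.2 * (ln 2)^(-7/5) * (j + 1)^(-7/5)]. The power of [ln 2] is at most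
    2 and the sum over [j] at most [5 / 2], so the total is at most [alpha * 5 / 5.2]. *)
Lemma sum_epoch_level_le (R : realType) (alpha : R) (n : nat) : 0 < alpha < 1 ->
  \sum_(1 <= j < n.+1) expR (- epoch_level alpha j) <= alpha.
Proof.
move=> /andP[a0 a1].
have l2 := ln2_ge R.
have l20 : 0 < ln 2 :> R by lra.
have c0 : 0 < 52 / 10 / alpha by rewrite divr_gt0 //; lra.
have e j : expR (- epoch_level alpha j) =
    (expR (- (7 / 5) * ln (ln 2)) * (alpha / (52 / 10))) *
    expR (- (7 / 5) * ln j.+1%:R).
  rewrite /epoch_level lnM ?posrE // opprD expRD mulrDr opprD expRD.
  rewrite [expR (- ln _)]expRN lnK ?posrE // invf_div -!mulNr; ring.
under eq_bigr do rewrite e.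
rewrite -mulr_sumr.
have E2 : expR (- (7 / 5) * ln (ln 2)) <= 2 :> R.
  apply: le_trans (expR_ln3half_le R); rewrite ler_expR mulNr -mulrN ler_pM2l //.
  rewrite lerNl -lnV ?posrE // ler_ln ?posrE ?invr_gt0 //.
  by rewrite invf_div.
have S2 := sum_zeta_le R n.
have S0 : 0 <= \sum_(1 <= i < n.+1) expR (- (7 / 5) * ln i.+1%:R) :> R.
  by apply: sumr_ge0 => i _; exact: expR_ge0.
have E0 := expR_ge0 (- (7 / 5) * ln (ln 2) : R).
apply: (le_trans (y := 2 * (alpha / (52 / 10)) * (5 / 2))); last by lra.
apply: ler_pM => //.
  by rewrite mulr_ge0 // divr_ge0 // ltW.
by rewrite ler_wpM2r // divr_ge0 // ltW.
Qed.

Lemma curved_boundary_dominated (R : realType) (alpha : R) (n : nat) :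
  0 < alpha < 1 -> line_dominated (curved_boundary alpha) alpha n.
Proof.
move=> a01.
have l2 := ln2_ge R.
have l20 : 0 < ln 2 :> R by lra.
have la := ln_curved_constant_ge a01; set la_ := ln (52 / 10 / alpha) in la.
pose v j : R := 7 / 5 * 2 ^+ j.
(* Among the lines of level [x], the choice [l = sqrt (2 x / v)] is the lowest at [v]: it is tangent
   there to [k |-> sqrt (2 x k)]. *)
pose line j : R * R :=
  (Num.sqrt (2 * epoch_level alpha j / v j), epoch_level alpha j).
exists [seq line j | j <- index_iota 1 n.+1]; split.
- by move=> _ /mapP[j _ ->]; exact: sqrtr_ge0.
- by rewrite big_map; exact: sum_epoch_level_le.
- move=> k s /andP[k0 kn] sk us.
  (* No line is spent on the epoch [j = 0]: the boundary at [k = 1] is at least 1, and a single sign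
     cannot exceed that. *)
  have [k1|k1] := leqP k 1.
    have k1' : k = 1%N by lia.
    exfalso; move: us; apply/negP; rewrite -leNgt; apply: le_trans sk _.
    rewrite /curved_boundary k1' mulr1 mul1r.
    have ll : - (1 / 2) <= ln (ln 2) :> R.
      have h : ln (2 / 3) <= ln (ln 2) :> R by rewrite ler_ln ?posrE //; lra.
      apply: le_trans h.
      rewrite lerNl -lnV ?posrE; last by lra.
      have -> : (2 / 3)^-1 = 1 + 1 / 2 :> R by lra.
      by apply: le_ln1Dx; lra.
    have q0 : 0 <= ln (ln 2) + 72 / 100 * la_ by lra.
    rewrite -ler_sqr ?nnegrE ?mulr_ge0 ?sqrtr_ge0 //.
    by rewrite exprMn sqr_sqrtr // -/la_; lra.
  have /andP[jk kj] := trunc_log_bounds (isT : (1 < 2)%N) k0.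
  set j := trunc_log 2 k in jk kj.
  have j1 : (1 <= j)%N by apply: trunc_log_max.
  have jn : (j <= n)%N.
    by apply: leq_trans kn; apply: leq_trans jk; rewrite ltnW // ltn_expl.
  have jkR : 2 ^+ j <= k%:R :> R by rewrite -natrX ler_nat.
  have kjR : k%:R <= 2 * 2 ^+ j :> R by rewrite -exprS -natrX ler_nat ltnW.
  have L0 : 1 < j.+1%:R * ln 2 :> R.
    have : 2 <= j.+1%:R :> R by rewrite (ler_nat _ 2).
    by nra.
  exists (line j).
    by apply/mapP; exists j => //; rewrite mem_index_iota j1 ltnS.
  have lL0 := ln_ge0 (ltW L0).
  apply: (@tangent_line_le _ _ _ (ln (ln (2 * k%:R)) + 72 / 100 * la_)).
  - by rewrite /v mulr_gt0 // exprn_gt0.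
  - by rewrite /line /epoch_level /= -/la_; lra.
  - by rewrite /v; lra.
  - have : ln (j.+1%:R * ln 2) <= ln (ln (2 * k%:R)) :> R.
      have h : j.+1%:R * ln 2 <= ln (2 * k%:R) :> R.
        rewrite mulr_natl -lnXn ?posrE // ler_ln ?posrE ?exprn_gt0 //.
          by rewrite exprS ler_pM2l.
        by rewrite mulr_gt0 // ltr0n.
      by rewrite ler_ln ?posrE //; lra.
    by rewrite /line /epoch_level /= -/la_; lra.
  - by apply: le_trans (ltW us).
Qed.

(** * Reflection and mirror-conservativeness on sets *)

(** By uniqueness of Lebesgue measure it suffices to test half-open intervals; reflection swaps
    which end is open and keeps the length. *)
Lemma lebesgue_measure_onem (R : realType) (A : set R) : measurable A ->
  pushforward (@lebesgue_measure R)
    ((fun x => 1 - x) : _ -> measurableTypeR R) A = lebesgue_measure A.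
Proof.
move=> mA.
pose phi (x : measurableTypeR R) : measurableTypeR R := 1 - x.
have mphi : measurable_fun setT phi by exact: measurable_funB.
pose mphi_mixin := isMeasurableFun.Build _ _ _ _ _ mphi.
pose f : {mfun measurableTypeR R >-> measurableTypeR R} := HB.pack phi mphi_mixin.
apply/esym/(@lebesgue_measure_unique R (pushforward lebesgue_measure f)) => //= _ [[a b]] _ <-.
rewrite /pushforward /=.
have -> : (fun x : R => 1 - x) @^-1` `]a, b]%classic = `[1 - b, 1 - a[%classic.
  apply/seteqP; split => x /=; rewrite !in_itv /= => /andP[h1 h2];
    apply/andP; split; lra.
rewrite !lebesgue_measure_itv /= !lte_fin ltrD2l ltrN2 -!EFinB.
by congr (if _ then _ else _); congr EFin; ring.
Qed.

Section mirror.
Variables (R : realType) (d : measure_display) (T : measurableType d).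
Variables (P : probability T R) (X : T -> R).
Hypothesis mX : measurable_fun setT X.

Lemma measurable_preimage (A : set R) : measurable A -> measurable (X @^-1` A).
Proof. by move=> mA; rewrite -[_ @^-1` _]setTI; exact: mX. Qed.

(** The pointwise inequality is summed over the atoms in the discrete case, and integrated in the
    density case, where the substitution [x |-> 1 - x] turns the integral of [f (1 - x)] over [A]
    into that of [f] over the reflected set. *)
Lemma mirror_conservative_le (A : set R) : mirror_conservative P X ->
  measurable A -> (forall a, A a -> 0 <= a <= 2^-1) ->
  (P (X @^-1` A) <= P (X @^-1` ((fun x => 1 - x)%R @^-1` A)))%E.
Proof.
move=> mc mA A01.
have mo : measurable_fun setT (fun x : R => 1 - x) by exact: measurable_funB.
have mpre (B : set R) : measurable B -> measurable ((fun x => 1 - x) @^-1` B).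
  by move=> mB; rewrite -[_ @^-1` _]setTI; exact: mo.
case: mc => [[S [cS [PS Sle]]]|[f [mf [f0 [fP fle]]]]]; last first.
  rewrite fP // fP; last exact: mpre.
  have mfo : measurable_fun setT (fun x : R => f (1 - x)).
    exact: (measurableT_comp mf mo).
  apply: (le_trans (y := (\int[lebesgue_measure]_(x in A) (f (1 - x))%:E)%E)).
    apply: ge0_le_integral => //.
    - by move=> x _; rewrite lee_fin.
    - by apply/measurable_EFinP; exact: measurable_funS mf.
    - by apply/measurable_EFinP; exact: measurable_funS mfo.
    - by move=> x /A01/fle; rewrite lee_fin.
  have -> : (\int[@lebesgue_measure R]_(x in (fun x => (1 - x)%R) @^-1` A) (f x)%:E)%E =
      (\int[lebesgue_measure]_(x in (fun x => (1 - x)%R) @^-1` A)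
         ((fun y => (f (1 - y))%:E) \o (fun x => (1 - x)%R)) x)%E.
    by apply: eq_integral => x _ /=; rewrite subKr.
  rewrite -(ge0_integral_pushforward (X := measurableTypeR R)
      (Y := measurableTypeR R)) //.
  - rewrite le_eqVlt; apply/orP; left; apply/eqP.
    by apply: eq_measure_integral => B mB _; exact/esym/lebesgue_measure_onem.
  - by apply/measurable_EFinP; exact: measurable_funS mfo.
  - by move=> x _; rewrite lee_fin.
have mS (B : set R) : B `<=` S -> measurable B.
  move=> BS; apply: countable_measurable; first exact: measurable_set1.
  exact: sub_countable (subset_card_le BS) cS.
have mSS : measurable S by exact: mS.
have AS : (P (X @^-1` A) <= P (X @^-1` (A `&` S)))%E.
  rewrite (measureDI P (measurable_preimage mA) (measurable_preimage mSS)).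
  rewrite [X in (X + _)%E](_ : _ = 0%E) ?add0e ?lexx //.
  apply: (@subset_measure0 _ _ _ P _ (~` (X @^-1` S))).
  - by apply: measurableD; exact: measurable_preimage.
  - by apply: measurableC; exact: measurable_preimage.
  - by move=> w [].
  - have := @probability_setC _ _ _ P (X @^-1` S); rewrite PS subee //.
    by apply; exact: measurable_preimage.
apply: (le_trans AS).
(* Numbering the atoms by [g] cuts [A] within the support into pieces [C n] of at most one point, to
   which countable additivity applies. *)
have /countable_injP[g ginj] : countable (A `&` S).
  by apply: sub_countable cS; apply: subset_card_le; exact: subIsetr.
pose C n := A `&` S `&` [set a | g a = n].
have mC n : measurable (C n) by apply: mS => a [[]].
have eC : A `&` S = \bigcup_n C n.
  by apply/seteqP; split => [a h|a [n _ []]//]; exists (g a).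
have mF n : measurable (X @^-1` C n) by exact: measurable_preimage.
have mG n : measurable (X @^-1` ((fun x => 1 - x) @^-1` C n)).
  by apply: measurable_preimage; exact: mpre.
apply: (le_trans (y := P (\bigcup_n (X @^-1` ((fun x => 1 - x) @^-1` C n))))).
  rewrite eC preimage_bigcup !measure_bigcup //; last 2 first.
  - move=> i j _ _ [w [[_ e1] [_ e2]]]; by rewrite -e1 -e2.
  - move=> i j _ _ [w [[_ e1] [_ e2]]]; by rewrite -e1 -e2.
  apply: lee_nneseries => [n _ _|n _]; first exact: measure_ge0.
  have [->|/set0P[a [[Aa Sa] ga]]] := eqVneq (C n) set0.
    by rewrite !preimage_set0.
  have -> : C n = [set a].
    apply/seteqP; split => [b [[Ab Sb] gb]|_ ->]; last by split.
    by apply: ginj; rewrite ?inE ?gb ?ga.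
  have -> : (fun x : R => 1 - x) @^-1` [set a] = [set (1 - a)%R].
    by apply/seteqP; split => x /=; [move=> <-|move=> ->]; rewrite subKr.
  exact/Sle/A01.
apply: le_measure; rewrite ?inE.
- by apply: bigcup_measurable.
- by apply: measurable_preimage; exact: mpre.
- by move=> w [n _ [[]]].
Qed.

(** Reflection maps the part of a symmetric [B] where the missing bit is 1 into the part where it is
    -1. Cutting down to the unit interval loses nothing and provides the bound [0 <= a] of the
    definition. *)
Lemma mirror_conservative_hbit (B : set R) : mirror_conservative P X ->
  (forall w, 0 <= X w <= 1) -> measurable B ->
  (forall x, 0 <= x <= 1 -> B x -> B (1 - x)) ->
  (P (X @^-1` (B `&` [set x : R | (x < 2^-1)%R])) <=
   P (X @^-1` (B `\` [set x : R | (x < 2^-1)%R])))%E.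
Proof.
move=> mc X01 mB sB.
have mlt : measurable [set x : R | x < 2^-1].
  by rewrite (_ : [set _ | _] = `]-oo, 2^-1[%classic).
pose A := B `&` [set x : R | (x < 2^-1)%R] `&` `[0, 1]%classic.
have mA : measurable A.
  by apply: measurableI; [exact: measurableI|exact: measurable_itv].
have -> : X @^-1` (B `&` [set x : R | (x < 2^-1)%R]) = X @^-1` A.
  apply/seteqP; split => w /=; last by case.
  by move=> h; split => //; rewrite /= in_itv /= X01.
apply: le_trans (mirror_conservative_le mc mA _) _.
  by move=> a [[_ /= h] /=]; rewrite in_itv /= => /andP[-> _]; rewrite ltW.
apply: le_measure; rewrite ?inE.
- apply: measurable_preimage; rewrite -[_ @^-1` _]setTI.
  by apply: (measurable_funB _ _ : measurable_fun setT (fun x : R => 1 - x)).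
- by apply: measurable_preimage; exact: measurableD.
- move=> w [[Bw /= lw] /=]; rewrite in_itv /= => /andP[h0 h1]; split.
    by have /= := sB (1 - X w); rewrite subKr; apply => //; rewrite h0 h1.
  by apply/negP; rewrite -leNgt; lra.
Qed.
End mirror.

(** * Union bound, measurability of comparisons, increasing unions *)

Section boole.
Variables (R : realType) (d : measure_display) (T : measurableType d).
Variable P : probability T R.

Lemma measure_bigsetU_seq_le (I : eqType) (s : seq I) (F : I -> set T) :
  (forall i, measurable (F i)) ->
  (P (\big[setU/set0]_(i <- s) F i) <= \sum_(i <- s) P (F i))%E.
Proof.
move=> mF; elim: s => [|i s IH]; first by rewrite !big_nil measure0.
rewrite !big_cons; apply: le_trans (leeD2l _ IH).
by apply: measureU2 => //; exact: bigsetU_measurable.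
Qed.

Lemma measurable_set_ltr (f g : T -> R) : measurable_fun setT f ->
  measurable_fun setT g -> measurable [set w | f w < g w].
Proof.
move=> mf mg; rewrite -[X in measurable X]setTI.
exact: (measurable_fun_ltr mf mg measurableT (Y := [set true])).
Qed.

Lemma measurable_set_ler (f g : T -> R) : measurable_fun setT f ->
  measurable_fun setT g -> measurable [set w | f w <= g w].
Proof.
move=> mf mg; rewrite -[X in measurable X]setTI.
exact: (measurable_fun_ler mf mg measurableT (Y := [set true])).
Qed.

Lemma nondecreasing_bigcup_le (F : nat -> set T) (a : \bar R) :
  (forall n, measurable (F n)) ->
  {homo F : m n / (m <= n)%N >-> (m <= n)%O} ->
  (forall n, (P (F n) <= a)%E) -> (P (\bigcup_n F n) <= a)%E.
Proof.
move=> mF ndF Fa.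
have cv := nondecreasing_cvg_mu (mu := P) mF (bigcupT_measurable _ mF) ndF.
rewrite -(cvg_lim _ cv) //; apply: lime_le; last exact: nearW.
by apply/cvg_ex; eexists; exact: cv.
Qed.

End boole.

(** * Boundary crossing for signs revealed in a fixed order, and its combination over cells *)

Section ordered_signs.
Variables (R : realType) (d : measure_display) (T : measurableType d).
Variables (P : probability T R) (n : nat) (p : 'I_n -> T -> R).
Hypothesis mp : forall i, measurable_fun setT (p i).
Hypothesis ip : mutually_independent P p.

Local Notation low := [set x : R | (x < 2^-1)%R].

Definition cylinder (B : 'I_n -> set R) : set T :=
  \bigcap_(j in [set: 'I_n]) (p j @^-1` B j).

Definition split_at (i : 'I_n) (S : set R) (B : 'I_n -> set R) (j : 'I_n) :=
  if j == i then B j `&` S else B j.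

Definition sign_sum (s : seq 'I_n) (w : T) : R := \sum_(i <- s) hbit (p i w).

(** The offset [y] is the exponent accumulated before the signs of [s]; it lets the induction peel
    off the first sign. The test itself starts from [y = 0]. *)
Definition crossing (l x y : R) (s : seq 'I_n) : set T :=
  [set w | exists2 k, (k <= size s)%N &
    x <= y + l * sign_sum (take k s) w - l ^+ 2 / 2 * k%:R].

Definition rejecting (u : nat -> R) (s : seq 'I_n) : set T :=
  [set w | exists2 k, (0 < k <= size s)%N & u k < sign_sum (take k s) w].

Definition sub_fair (A : set R) (i : 'I_n) :=
  (P (p i @^-1` (A `&` low)) <= P (p i @^-1` (A `\` low)))%E.

Lemma measurable_low : measurable low.
Proof.
by rewrite (_ : low = `]-oo, 2^-1[%classic).
Qed.

Lemma measurable_sign_sum (s : seq 'I_n) : measurable_fun setT (sign_sum s).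
Proof.
apply: measurable_sum => i.
by apply: measurable_fun_ifT => //; exact: measurable_fun_ltr.
Qed.

Lemma sign_sum_le (s : seq 'I_n) (w : T) : sign_sum s w <= (size s)%:R.
Proof.
elim: s => [|i s IH]; first by rewrite /sign_sum big_nil.
rewrite /sign_sum big_cons /= -natr1 addrC lerD //.
by rewrite /hbit; case: ifP => _ //; lra.
Qed.

Lemma measurable_crossing (l x y : R) (s : seq 'I_n) :
  measurable (crossing l x y s).
Proof.
apply: bigcup_measurable => k _; apply: measurable_set_ler => //.
apply: measurable_funB => //; apply: measurable_funD => //.
by apply: measurable_funM => //; exact: measurable_sign_sum.
Qed.

Lemma measurable_rejecting (u : nat -> R) (s : seq 'I_n) :
  measurable (rejecting u s).
Proof.
apply: bigcup_measurable => k _; apply: measurable_set_ltr => //.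
exact: measurable_sign_sum.
Qed.

Lemma measurable_cylinder (B : 'I_n -> set R) :
  (forall j, measurable (B j)) -> measurable (cylinder B).
Proof.
move=> mB; apply: fin_bigcap_measurable; first exact: finite_finset.
by move=> j _; exact: measurable_preimage.
Qed.

(** Independence turns both sides into products over all hypotheses, which are monotone in their
    nonnegative factors. *)
Lemma cylinder_le (B C : 'I_n -> set R) :
  (forall j, measurable (B j)) -> (forall j, measurable (C j)) ->
  (forall j, (P (p j @^-1` B j) <= P (p j @^-1` C j))%E) ->
  (P (cylinder B) <= P (cylinder C))%E.
Proof.
move=> mB mC BC.
have E (D : 'I_n -> set R) : (forall j, measurable (D j)) ->
    P (cylinder D) = (\prod_(j <- enum 'I_n) P (p j @^-1` D j))%E.
  move=> mD; rewrite -ip ?enum_uniq //; congr (P (bigcap _ _)).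
  by apply/seteqP; split => j //= _; rewrite mem_enum.
rewrite !E //.
suff [] : ((0 <= \prod_(j <- enum 'I_n) P (p j @^-1` B j)) /\
  (\prod_(j <- enum 'I_n) P (p j @^-1` B j) <=
   \prod_(j <- enum 'I_n) P (p j @^-1` C j)))%E by [].
apply: (big_rec2 (fun x y => (0 <= x)%E /\ (x <= y)%E)) => [//|j x y _ [x0 xy]].
by split; [exact: mule_ge0|exact: lee_pmul].
Qed.

Lemma cylinder_split_at (i : 'I_n) (S : set R) (B : 'I_n -> set R) :
  cylinder (split_at i S B) = cylinder B `&` p i @^-1` S.
Proof.
apply/seteqP; split => w.
  move=> h; split; last by have := h i I; rewrite /split_at eqxx => -[].
  by move=> j _; have := h j I; rewrite /split_at; case: eqP => // _ [].
by move=> [h Sw] j _; rewrite /split_at; case: eqP => [->|_]; [split|]; try exact: h.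
Qed.

Lemma measurable_split_at (i : 'I_n) (S : set R) (B : 'I_n -> set R) :
  measurable S -> (forall j, measurable (B j)) ->
  forall j, measurable (split_at i S B j).
Proof.
by move=> mS mB j; rewrite /split_at; case: ifP => // _; exact: measurableI.
Qed.

(* Ville's maximal inequality for [exp (l S_k - l^2 k / 2)], conditionally on
   the cylinder, by induction on the order in which the signs are revealed. *)
Lemma crossing_le (l x y : R) (s : seq 'I_n) (B : 'I_n -> set R) :
  0 <= l -> uniq s -> (forall j, measurable (B j)) ->
  (forall j, j \in s -> sub_fair (B j) j) ->
  (P (cylinder B `&` crossing l x y s) <= (expR (y - x))%:E * P (cylinder B))%E.
Proof.
move=> l0; elim: s y B => [|i s IH] y B us mB fB.
all: have mcB := measurable_cylinder mB.
all: have mI := measurableI _ _ mcB (measurable_crossing _ _ _ _).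
all: have [xy|yx] := leP x y.
- apply: (@le_trans _ _ (P (cylinder B))).
    by apply: le_measure; rewrite ?inE //; exact: subIsetl.
  rewrite -[leLHS]mul1e lee_wpmul2r ?measure_ge0 // lee_fin.
  by rewrite -expR0 ler_expR subr_ge0.
- rewrite [X in P X](_ : _ = set0) ?measure0 ?mule_ge0 ?lee_fin ?expR_ge0 //.
  apply/seteqP; split => w // [_ [k]] /=; rewrite leqn0 => /eqP ->.
  by rewrite /sign_sum big_nil !mulr0 addr0 subr0 leNgt yx.
- apply: (@le_trans _ _ (P (cylinder B))).
    by apply: le_measure; rewrite ?inE //; exact: subIsetl.
  rewrite -[leLHS]mul1e lee_wpmul2r ?measure_ge0 // lee_fin.
  by rewrite -expR0 ler_expR subr_ge0.
have /andP[is_ us'] := us.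
(* Reveal the sign of [i]: the cylinder splits in two, and the offset moves by [l - l^2 / 2] or
   [- l - l^2 / 2]. The other coordinates of the cylinder stay as they were, so the induction
   hypothesis applies to both halves. *)
pose Bp := split_at i low B; pose Bm := split_at i (~` low) B.
have mlow := measurable_low.
have mBp : forall j, measurable (Bp j) by exact: measurable_split_at.
have mBm : forall j, measurable (Bm j).
  by apply: measurable_split_at => //; exact: measurableC.
have fBp j : j \in s -> sub_fair (Bp j) j.
  move=> js; rewrite /Bp /split_at; case: eqP => [ji|_].
    by rewrite -ji js in is_.
  by apply: fB; rewrite inE js orbT.
have fBm j : j \in s -> sub_fair (Bm j) j.
  move=> js; rewrite /Bm /split_at; case: eqP => [ji|_].
    by rewrite -ji js in is_.
  by apply: fB; rewrite inE js orbT.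
pose yp := y + (l - l ^+ 2 / 2); pose ym := y + (- l - l ^+ 2 / 2).
have sub : cylinder B `&` crossing l x y (i :: s) `<=`
    (cylinder Bp `&` crossing l x yp s) `|` (cylinder Bm `&` crossing l x ym s).
  move=> w [Bw [[|k] /= ks]].
    by rewrite /sign_sum big_nil !mulr0 addr0 subr0 leNgt yx.
  rewrite /sign_sum big_cons -/(sign_sum _ w) => cw.
  have [lw|lw] := ltP (p i w) 2^-1; [left|right].
    rewrite cylinder_split_at; split => //; exists k => //.
    by move: cw; rewrite /hbit lw /yp -natr1; lra.
  rewrite cylinder_split_at; split.
    by split => //=; apply/negP; rewrite -leNgt.
  exists k => //.
  by move: cw; rewrite /hbit ltNge lw /= /ym -natr1; lra.
apply: (@le_trans _ _ (P (cylinder Bp `&` crossing l x yp s) +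
                       P (cylinder Bm `&` crossing l x ym s))%E).
  have mp_ := measurableI _ _ (measurable_cylinder mBp) (measurable_crossing l x yp s).
  have mm_ := measurableI _ _ (measurable_cylinder mBm) (measurable_crossing l x ym s).
  apply: le_trans (measureU2 _ mp_ mm_); apply: le_measure; rewrite ?inE //.
  exact: measurableU.
apply: (le_trans (leeD (IH yp Bp us' mBp fBp) (IH ym Bm us' mBm fBm))).
have pm : (P (cylinder Bp) <= P (cylinder Bm))%E.
  apply: cylinder_le => // j; rewrite /Bp /Bm /split_at; case: eqP => // ->.
  by rewrite -setDE; apply: fB; rewrite mem_head.
have -> : P (cylinder B) = (P (cylinder Bp) + P (cylinder Bm))%E.
  rewrite /Bp /Bm !cylinder_split_at addeC preimage_setC -setDE.
  exact: (measureDI P mcB (measurable_preimage (mp i) mlow)).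
have fin E : measurable E -> P E = (fine (P E))%:E.
  by move=> mE; rewrite fineK // fin_num_measure.
move: pm; rewrite (fin _ (measurable_cylinder mBp)) (fin _ (measurable_cylinder mBm)).
set a := fine _; set b := fine _; rewrite lee_fin => ab.
have a0 : 0 <= a by exact: fine_ge0.
rewrite -(EFinD a b) -!EFinM -EFinD lee_fin /yp /ym.
have -> : y + (l - l ^+ 2 / 2) - x = (y - x) + (l - l ^+ 2 / 2) by ring.
have -> : y + (- l - l ^+ 2 / 2) - x = (y - x) + (- l - l ^+ 2 / 2) by ring.
rewrite !(expRD (y - x)).
have := expR_sub_half_sqr_le l.
have : expR (- l - l ^+ 2 / 2) <= expR (l - l ^+ 2 / 2) by rewrite ler_expR; lra.
set cp := expR (l - _); set cm := expR (- l - _) => cmp c2.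
rewrite -!mulrA -mulrDr ler_pM2l ?expR_gt0 //.
(* The goal [cp a + cm b <= a + b] is the sum of these two inequalities. The first needs [a <= b],
   that is, a bit 1 being no likelier than -1. *)
have : 0 <= (1 - cm) * (b - a) by rewrite mulr_ge0; lra.
have : 0 <= (2 - cp - cm) * a by rewrite mulr_ge0 //; lra.
by lra.
Qed.

(** Union bound over the dominating lines: a rejection crosses one of them, and their errors sum to
    at most [alpha]. *)
Lemma rejecting_le (u : nat -> R) (alpha : R) (s : seq 'I_n)
    (B : 'I_n -> set R) :
  line_dominated u alpha (size s) -> uniq s -> (forall j, measurable (B j)) ->
  (forall j, j \in s -> sub_fair (B j) j) ->
  (P (cylinder B `&` rejecting u s) <= alpha%:E * P (cylinder B))%E.
Proof.
move=> [L [L0 La Lu]] us mB fB.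
have mcB := measurable_cylinder mB.
have mF v : measurable (cylinder B `&` crossing v.1 v.2 0 s).
  by apply: measurableI => //; exact: measurable_crossing.
apply: (@le_trans _ _
    (P (\big[setU/set0]_(v <- L) (cylinder B `&` crossing v.1 v.2 0 s)))).
  apply: le_measure; rewrite ?inE.
  - by apply: measurableI => //; exact: measurable_rejecting.
  - exact: bigsetU_measurable.
  - move=> w [Bw [k ks uk]].
    have [|v vL vk] := Lu k _ ks _ uk.
      apply: le_trans (sign_sum_le _ _) _.
      by rewrite ler_nat size_take_min geq_minl.
    rewrite -bigcup_seq; exists v => //; split => //; exists k.
      by case/andP: ks.
    by rewrite add0r.
apply: (le_trans (measure_bigsetU_seq_le _ _ mF)).
apply: (@le_trans _ _ (\sum_(v <- L) (expR (- v.2))%:E * P (cylinder B))%E).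
  rewrite big_seq [leRHS]big_seq; apply: lee_sum => v vL.
  by rewrite -[- v.2]add0r; apply: crossing_le => //; exact: L0.
rewrite -ge0_sume_distrl; last by move=> v _; rewrite lee_fin expR_ge0.
by rewrite lee_wpmul2r ?measure_ge0 // sumEFin lee_fin.
Qed.

Variables (Z : finType) (cell : R -> Z).
Hypothesis mcell : forall c, measurable (cell @^-1` [set c]).

Definition cells (w : T) : {ffun 'I_n -> Z} := [ffun i => cell (p i w)].

(** Total probability: the finitely many cell patterns partition the space into cylinders. The rule
    may depend on the pattern, which is how an order chosen from masked values is allowed. *)
Lemma cellwise_le (rule : {ffun 'I_n -> Z} -> set T) (alpha : R) :
  0 <= alpha -> (forall z, measurable (rule z)) ->
  (forall z : {ffun 'I_n -> Z},
     P (cylinder (fun i => cell @^-1` [set z i]) `&` rule z) <=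
     alpha%:E * P (cylinder (fun i => cell @^-1` [set z i])))%E ->
  measurable [set w | rule (cells w) w] /\
  (P [set w | rule (cells w) w] <= alpha%:E)%E.
Proof.
move=> a0 mr ra.
pose E (z : {ffun 'I_n -> Z}) := cylinder (fun i => cell @^-1` [set z i]).
have Ecells z w : E z w <-> cells w = z.
  split=> [Ew|<- i _]; last by rewrite /= ffunE.
  by apply/ffunP => i; rewrite ffunE; exact: (Ew i I).
have mE z : measurable (E z) by exact: measurable_cylinder.
have tE : trivIset setT E.
  by move=> z z' _ _ [w [/Ecells <- /Ecells <-]].
have mEr z : measurable (E z `&` rule z) by exact: measurableI.
have eR : [set w | rule (cells w) w] =
    \bigcup_(z in [set: {ffun 'I_n -> Z}]) (E z `&` rule z).
  apply/seteqP; split=> [w rw|w [z _ [/Ecells <-]]] //.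
  by exists (cells w) => //; split => //; exact/Ecells.
have fT : finite_set [set: {ffun 'I_n -> Z}] by exact: finite_finset.
split; first by rewrite eR; exact: fin_bigcup_measurable.
rewrite eR measure_fin_bigcup //; last first.
  by move=> z z' _ _ [w [[/Ecells <- _] [/Ecells <- _]]].
apply: (@le_trans _ _ (\sum_(z \in [set: {ffun 'I_n -> Z}]) alpha%:E * P (E z))%E).
  by apply: lee_fsum => // z _; exact: ra.
rewrite -ge0_mule_fsumr // -measure_fin_bigcup //.
have -> : \bigcup_(z in [set: {ffun 'I_n -> Z}]) E z = setT.
  by apply/seteqP; split => w // _; exists (cells w) => //; exact/Ecells.
by rewrite -[leRHS]mule1 -(probability_setT P).
Qed.

End ordered_signs.

(** * Ranks and the order of inclusion *)

Lemma take_enum_ord (n k : nat) :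
  take k (enum 'I_n) = [seq i : 'I_n <- enum 'I_n | (i < k)%N].
Proof.
apply: (inj_map val_inj); rewrite map_take val_enum_ord.
rewrite -(filter_map val (fun i => (i < k)%N)) val_enum_ord.
have [kn|nk] := leqP k n; last first.
  rewrite take_oversize ?size_iota 1?ltnW //.
  apply/esym/all_filterP/allP => i; rewrite mem_iota add0n => /= /ltn_trans; exact.
rewrite -(subnKC kn) iotaD add0n filter_cat take_size_cat ?size_iota //.
rewrite (all_filterP _); last by apply/allP => i; rewrite mem_iota.
rewrite (_ : [seq _ <- iota k _ | _] = [::]) ?cats0 //.
apply/eqP; rewrite -(negbK (_ == _)) -has_filter; apply/hasPn => i.
by rewrite mem_iota -leqNgt => /andP[].
Qed.

Section brank.
Variables (R : realType) (n : nat) (q : 'I_n -> R).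

Lemma brankE (i : 'I_n) : brank q i =
  #|[pred j : 'I_n | (q j < q i) || ((q j == q i) && (j < i)%N)]|.
Proof. by apply: eq_card => j; apply/idP/idP; rewrite !inE. Qed.

Lemma brank_mono (i j : 'I_n) :
  (q i < q j) || ((q i == q j) && (i < j)%N) -> (brank q i < brank q j)%N.
Proof.
move=> ij; rewrite !brankE; apply: proper_card; apply/properP; split.
  apply/fintype.subsetP => k; rewrite !inE.
  case/orP: ij => [ij|/andP[/eqP ij lij]] /orP[ki|/andP[/eqP ki lki]].
  - by rewrite (lt_trans ki ij).
  - by rewrite ki ij.
  - by rewrite -ij ki.
  - by rewrite -ij ki eqxx (ltn_trans lki lij) orbT.
by exists i; rewrite !inE // ltxx ltnn andbF.
Qed.

Lemma brank_inj : injective (brank q).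
Proof.
move=> i j e; apply/eqP/negPn/negP => ij.
have [qij|qij|qij] := ltgtP (q i) (q j).
- by have := @brank_mono i j; rewrite e ltnn qij => /(_ isT).
- by have := @brank_mono j i; rewrite e ltnn qij => /(_ isT).
have [lij|lij|lij] := ltngtP i j.
- by have := @brank_mono i j; rewrite e ltnn qij eqxx lij orbT => /(_ isT).
- by have := @brank_mono j i; rewrite e ltnn qij eqxx lij orbT => /(_ isT).
- by move/negP: ij; apply; apply/eqP/val_inj.
Qed.

Lemma brank_lt (i : 'I_n) : (brank q i < n)%N.
Proof.
rewrite brankE -[ltnRHS]card_ord; apply: proper_card; apply/properP.
split; first by apply/fintype.subsetP => j; rewrite inE.
by exists i; rewrite !inE // ltxx ltnn andbF.
Qed.

(** An injective rank with values below [n] is a permutation; its inverse lists the hypotheses in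
    order of inclusion, so that [M_k] is [take k s]. *)
Lemma brank_order : exists s : seq 'I_n, [/\ uniq s, size s = n &
  forall k (F : 'I_n -> R),
    \sum_(i | (brank q i < k)%N) F i = \sum_(i <- take k s) F i].
Proof.
pose r i := Ordinal (brank_lt i).
have r_inj : injective r by move=> i j [/brank_inj].
have g_inj : injective (invF r_inj) := can_inj (f_invF r_inj).
exists (map (invF r_inj) (enum 'I_n)); split.
- by rewrite map_inj_uniq // enum_uniq.
- by rewrite size_map size_enum_ord.
move=> k F; rewrite -map_take big_map take_enum_ord big_filter big_enum_cond /=.
rewrite (reindex_inj g_inj) /=; apply: eq_bigl => i.
by have /(congr1 val)/= -> := f_invF r_inj i.
Qed.

End brank.

(** Ranks depend only on strict comparisons and ties, so a coarser resolution that respects both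
    gives the same order. *)
Lemma eq_brank (R : realType) (n : nat) (q q' : 'I_n -> R) :
  (forall i j, q i < q j -> q' i < q' j) ->
  (forall i j, q i = q j -> q' i = q' j) -> brank q =1 brank q'.
Proof.
move=> lt_qq' eq_qq' i; rewrite !brankE; apply: eq_card => j; rewrite !inE.
have [ij|ij|ij] := ltgtP (q j) (q i).
- by rewrite lt_qq'.
- by rewrite lt_gtF ?gt_eqF ?lt_qq'.
- by rewrite (eq_qq' _ _ ij) ltxx eqxx.
Qed.

Lemma gmask_onem (R : realType) (x : R) : gmask (1 - x) = gmask x.
Proof. by rewrite /gmask subKr minC. Qed.

Lemma measurable_gmask (R : realType) : measurable_fun setT (@gmask R).
Proof. by apply: measurable_minr => //; exact: measurable_funB. Qed.

Lemma mutually_independent_ord (R : realType) (d : measure_display)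
    (T : measurableType d) (P : probability T R) (p : nat -> T -> R) (t : nat) :
  mutually_independent P p ->
  mutually_independent P (fun i : 'I_t => p i).
Proof.
move=> ip J B uJ mB.
pose B' (k : nat) := if insub k is Some i then B i else setT : set R.
have B'E (i : 'I_t) : B' i = B i by rewrite /B' valK.
have := ip (map val J) B'; rewrite map_inj_uniq; last exact: val_inj.
rewrite big_map; under [X in _ -> _ -> _ = X]eq_bigr do rewrite B'E.
move=> <- //; last by move=> _ /mapP[i iJ ->]; rewrite B'E; exact: mB.
congr (P _); apply/seteqP; split => w h.
  by move=> _ /mapP[i iJ ->]; rewrite B'E; exact: h.
by move=> i iJ; have := h i; rewrite B'E; apply; apply/mapP; exists i.
Qed.

(** * The batch and online tests *)

Section tests.
Variables (R : realType) (d : measure_display) (T : measurableType d).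
Variables (P : probability T R) (alpha : R) (u : nat -> R).
Hypothesis alpha0 : 0 <= alpha.
Hypothesis udom : forall n, line_dominated u alpha n.

Section cells.
Variables (n : nat) (p : 'I_n -> T -> R).
Hypothesis mp : forall i, measurable_fun setT (p i).
Hypothesis p01 : forall i w, 0 <= p i w <= 1.
Hypothesis ip : mutually_independent P p.
Hypothesis mcp : forall i, mirror_conservative P (p i).
Variables (Z : finType) (cell : R -> Z).
Hypothesis mcell : forall c, measurable (cell @^-1` [set c]).
Hypothesis cell_onem : forall x, cell (1 - x) = cell x.

(** The common form of both tests. Cells symmetric under reflection tell nothing beyond the masked
    values, so each bit stays at most fair given its cell; given all cells, the test only has to be
    contained in one with a fixed order. *)
Lemma adaptive_test_le (rule : {ffun 'I_n -> Z} -> set T) :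
  (forall z, measurable (rule z)) ->
  (forall z, exists2 s, uniq s & rule z `<=` rejecting p u s) ->
  measurable [set w | rule (cells p cell w) w] /\
  (P [set w | rule (cells p cell w) w] <= alpha%:E)%E.
Proof.
move=> mr rs; apply: cellwise_le => // z; have [s us zs] := rs z.
have mB j : measurable (cell @^-1` [set z j]) by exact: mcell.
have mcyl := measurable_cylinder mp mB.
apply: le_trans (rejecting_le mp ip (udom _) us mB _).
  apply: le_measure; rewrite ?inE.
  - exact: measurableI.
  - by apply: measurableI => //; exact: measurable_rejecting.
  - by move=> w [? /zs].
move=> j _; apply: mirror_conservative_hbit => // x _ /= <-.
exact: cell_onem.
Qed.

End cells.

Lemma batch_reject_le (n : nat) (p : 'I_n -> T -> R) :
  (forall i, measurable_fun setT (p i)) ->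
  (forall i w, 0 <= p i w <= 1) ->
  mutually_independent P p ->
  (forall i, mirror_conservative P (p i)) ->
  (P (batch_reject u p) <= alpha%:E)%E.
Proof.
move=> mp p01 ip mcp.
(* [level N] is [floor (N g)], as a cardinal so that the cells are finite. *)
pose cell N (x : R) := [ffun k : 'I_N => k.+1%:R <= N%:R * gmask x].
pose level N (z : {ffun 'I_N -> bool}) : R := #|[pred k | z k]|%:R.
pose rule N (z : {ffun 'I_n -> {ffun 'I_N -> bool}}) := [set w | exists2 k,
  (1 <= k <= n)%N &
  u k < \sum_(i | (brank (fun j => level N (z j)) i < k)%N) hbit (p i w)].
pose B N := [set w | rule N (cells p (cell N) w) w].
have mcell N c : measurable (cell N @^-1` [set c]).
  rewrite (_ : _ @^-1` _ = \bigcap_(k in [set: 'I_N])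
      ((fun x => k.+1%:R <= N%:R * gmask x) @^-1` [set c k])); last first.
    apply/seteqP; split => [x /= <- k _|x xc] /=; first by rewrite ffunE.
    by apply/ffunP => k; rewrite ffunE; exact: xc.
  apply: fin_bigcap_measurable => [|k _]; first exact: finite_finset.
  rewrite -[X in measurable X]setTI.
  apply: (measurable_fun_ler _ _ measurableT) => //.
  by apply: measurable_funM => //; exact: measurable_gmask.
have cell_onem N x : cell N (1 - x) = cell N x.
  by apply/ffunP => k; rewrite !ffunE gmask_onem.
have BP N : measurable (B N) /\ (P (B N) <= alpha%:E)%E.
  apply: (@adaptive_test_le n p mp p01 ip mcp _ (cell N) (mcell N) (cell_onem N)
    (rule N)) => z;
    have [s [us ss es]] := brank_order (fun j => level N (z j)).
    rewrite (_ : rule N z = rejecting p u s); first exact: measurable_rejecting.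
    apply/seteqP; split => w [k kn uk]; exists k.
    - by rewrite ss.
    - by rewrite /sign_sum -es.
    - by rewrite -ss.
    - by rewrite es.
  exists s => // w [k kn uk]; exists k; first by rewrite ss.
  by rewrite /sign_sum -es.
have evB w : \forall N \near \oo, B N w <-> batch_reject u p w.
  pose g j := gmask (p j w).
  have g0 j : 0 <= g j.
    by rewrite /g /gmask le_min; have := p01 j w; lra.
  have g1 j : g j <= 1.
    by rewrite /g /gmask ge_min; have /andP[_ ->] := p01 j w.
  have ev : \forall N \near \oo, forall i j, g i < g j ->
      level N (cell N (p i w)) < level N (cell N (p j w)).
    apply: filter_forall => i; apply: filter_forall => j.
    have [gij|gij] := ltP (g i) (g j); last by apply: nearW.
    near=> N => _.
    (* A gap of at least 1 after scaling leaves an integer in the interval from [N g i] (excluded)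
       to [N g j] (included): the successor of the floor of [N g i]. Its threshold counts for [j]
       and not for [i]. *)
    have Ng : 1 <= N%:R * (g j - g i).
      rewrite -ler_pdivrMr ?subr_gt0 //.
      by near: N; exact: nbhs_infty_ger.
    have Ni0 : 0 <= N%:R * g i by rewrite mulr_ge0.
    have Ngj : N%:R * g j <= N%:R by rewrite ler_piMr.
    have /andP[K1 K2] := truncn_itv Ni0.
    have KN : (Num.truncn (N%:R * g i) < N)%N by rewrite truncn_lt_nat //; lra.
    rewrite ltr_nat; apply: proper_card; apply/properP; split.
      apply/fintype.subsetP => k; rewrite !inE !ffunE => /le_trans; apply.
      by rewrite ler_wpM2l // ltW.
    exists (Ordinal KN); rewrite !inE !ffunE /= -?ltNge //.
    by rewrite -natr1 -/(g j); lra.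
  near=> N.
  have evN : forall i j, g i < g j ->
      level N (cell N (p i w)) < level N (cell N (p j w)) by near: N.
  have eqb : brank g =1 brank (fun j => level N (cells p (cell N) w j)).
    apply: eq_brank => i j; rewrite !ffunE; first exact: evN.
    by move=> gij; congr level; apply/ffunP => k; rewrite !ffunE -/(g i) gij.
  have es k : batch_sum p k w =
      \sum_(i | (brank (fun j => level N (cells p (cell N) w j)) i < k)%N)
        hbit (p i w).
    by apply: eq_bigl => i; rewrite eqb.
  split => [[k kn uk]|[k [kn uk]]]; exists k => //.
    by rewrite es.
  by rewrite -es.
(* Since membership in [B N] is eventually that in the rejection event, the latter is the lower
   limit of the [B N]: an increasing union of sets, the one of index [M] lying inside [B M]. *)
have -> : batch_reject u p = \bigcup_M \bigcap_(N in [set N | (M <= N)%N]) B N.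
  apply/seteqP; split => [w rw|w [M _ Mw]].
    have [M _ MB] := evB w; exists M => // N MN; exact/(MB N MN).
  have [M' _ MB] := evB w; apply/(MB (maxn M M')); first exact: leq_maxr.
  by apply: Mw => /=; exact: leq_maxl.
have mC M : measurable (\bigcap_(N in [set N | (M <= N)%N]) B N).
  by apply: bigcap_measurableType => N _; case: (BP N).
apply: nondecreasing_bigcup_le => // [M M' MM'|M].
  by apply/subsetPset => w h N /= MN; apply: h => /=; exact: leq_trans MN.
apply: le_trans (proj2 (BP M)); apply: le_measure; rewrite ?inE //.
- by case: (BP M).
- by move=> w; apply => /=.
Unshelve. all: by end_near. Qed.

Lemma online_reject_le (c : R) (p : nat -> T -> R) :
  (forall i, measurable_fun setT (p i)) ->
  (forall i w, 0 <= p i w <= 1) ->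
  mutually_independent P p ->
  (forall i, mirror_conservative P (p i)) ->
  (P (online_reject u c p) <= alpha%:E)%E.
Proof.
move=> mp p01 ip mcp.
pose cell (x : R) := gmask x < c.
(* Rejection by time [t] involves only the first [t] hypotheses; allowing every [t' <= t] makes
   these events increase with [t]. *)
pose A t := [set w | exists2 t', (t' <= t)%N & (1 <= online_count c p t' w)%N /\
  u (online_count c p t' w) < online_sum c p t' w].
have AP t : measurable (A t) /\ (P (A t) <= alpha%:E)%E.
  pose q (i : 'I_t) := p i.
  pose s (z : {ffun 'I_t -> bool}) t' := [seq i <- take t' (enum 'I_t) | z i].
  pose rule z := [set w | exists2 t', (t' <= t)%N && (0 < size (s z t'))%N &
    u (size (s z t')) < sign_sum q (s z t') w].
  have sumE (V : nmodType) (F : nat -> V) t' w : (t' <= t)%N ->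
      \sum_(i < t' | gmask (p i w) < c) F i =
      \sum_(i <- s (cells q cell w) t') F i.
    move=> tt; rewrite (big_ord_widen_cond _ (fun i => gmask (p i w) < c) F tt).
    rewrite /s take_enum_ord -filter_predI big_filter big_enum_cond /=.
    by apply: eq_bigl => i; rewrite ffunE.
  have countE t' w : (t' <= t)%N ->
      online_count c p t' w = size (s (cells q cell w) t').
    by move=> tt; rewrite -sum1_size; exact: (sumE nat (fun=> 1%N)).
  have -> : A t = [set w | rule (cells q cell w) w].
    apply/seteqP; split => w [t' tt].
      by rewrite countE // /online_sum (sumE R (fun i => hbit (p i w))) // =>
        -[k0 us]; exists t' => //; rewrite tt.
    case/andP: tt => tt k0 us; exists t' => //.
    by rewrite countE // /online_sum (sumE R (fun i => hbit (p i w))).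
  apply: (@adaptive_test_le t q (fun i => mp i) (fun i => p01 i)
    (mutually_independent_ord ip) (fun i => mcp i) _ cell).
  - move=> b; rewrite -[X in measurable X]setTI.
    by apply: (measurable_fun_ltr _ _ measurableT) => //; exact: measurable_gmask.
  - by move=> x; rewrite /cell gmask_onem.
  - move=> z; apply: bigcup_measurable => t' _; apply: measurable_set_ltr => //.
    by apply: measurable_sign_sum => i; exact: mp.
  (* The set held at any time [t' <= t] is a prefix of the list of all hypotheses included by time
     [t], so this one order serves for every [t']. *)
  - move=> z; exists [seq i <- enum 'I_t | z i].
      by rewrite filter_uniq // enum_uniq.
    move=> w [t' /andP[tt k0] us]; exists (size (s z t')).
      rewrite k0 -[in leqRHS](cat_take_drop t' (enum 'I_t)) filter_cat size_cat.
      exact: leq_addr.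
    rewrite -[in take _ _](cat_take_drop t' (enum 'I_t)) filter_cat.
    by rewrite take_size_cat.
have -> : online_reject u c p = \bigcup_t A t.
  apply/seteqP; split => [w [t tw]|w [t _ [t' _ tw]]]; last by exists t'.
  by exists t => //; exists t.
apply: nondecreasing_bigcup_le => [t|t t' tt|t].
- by case: (AP t).
- by apply/subsetPset => w [t0 h hw]; exists t0 => //; exact: leq_trans tt.
- by case: (AP t).
Qed.

End tests.

Theorem theorem2 (R : realType) (d : measure_display) (T : measurableType d)
  (P : probability T R) (alpha : R) (u : nat -> R) :
  0 < alpha < 1 ->
  ((exists m : R, 0 < m /\ u = lin_boundary m alpha) \/ u = curved_boundary alpha) ->
  (forall (n : nat) (p : 'I_n -> T -> R),
     (forall i, measurable_fun setT (p i)) ->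
     (forall i w, 0 <= p i w <= 1) ->
     mutually_independent P p ->
     (forall i, mirror_conservative P (p i)) ->
     (P (batch_reject u p) <= alpha%:E)%E)
  /\
  (forall (c : R) (p : nat -> T -> R),
     (forall i, measurable_fun setT (p i)) ->
     (forall i w, 0 <= p i w <= 1) ->
     mutually_independent P p ->
     (forall i, mirror_conservative P (p i)) ->
     (P (online_reject u c p) <= alpha%:E)%E).
Proof.
move=> a01 hu.
have a0 : 0 <= alpha by case/andP: a01 => /ltW.
have udom n : line_dominated u alpha n.
  by case: hu => [[m [m0 ->]]|->];
    [exact: lin_boundary_dominated|exact: curved_boundary_dominated].
by split => [n p|c p]; [exact: batch_reject_le|exact: online_reject_le].
Qed.
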